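(* Let $\mu$ be a probability measure on $\mathbb{R}$, absolutely continuous with density $f$, whose support is not included in $(-\infty,0)$. Assume there is $a\ge0$ and a positive Borel measure $\nu$ on $(0,\infty)$ such that $f(t)=\int_0^\infty e^{-ut}\,\nu(du)$ for all $t>a$ (i.e. $f$ is completely monotone on $(a,\infty)$), and that the support of $\nu$ contains an increasing sequence $(a_n)$ with $\sum_n a_n^{-1}=+\infty$. Then: (i) for any two nonnegative Borel functions $g_1,g_2$ on $[0,\infty)$ such that $\int_0^\infty f(t+s)g_1(s)\,ds<\infty$ and $\int_0^\infty f(t+s)g_2(s)\,ds<\infty$ for all $t\ge0$, if $\int_0^\infty f(t+s)g_1(s)\,ds=\int_0^\infty f(t+s)g_2(s)\,ds$ for all $t\ge 0$ then $g_1=g_2$ almost everywhere; (ii) $\mu$ is characterized by the restrictions of $\mu$ and $\mu*\mu$ to $[0,\infty)$, i.e. any probability measure $\mu_1$ on $\mathbb{R}$ with $\mu_1=\mu$ and $\mu_1*\mu_1=\mu*\mu$ on the Borel subsets of $[0,\infty)$ equals $\mu$; (iii) in particular $\mu\in\mathscr{C}$.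
   Context: $\mathscr{C}$ is the set of probability measures $\mu$ on $\mathbb{R}$ such that every probability measure $\mu_1$ with $\mu_1^{*n}=\mu^{*n}$ on $[0,\infty)$ for all $n\ge1$ ($*n$ = $n$-fold convolution power) equals $\mu$. *)

(* Defs.v *)
From HB Require Import structures.
From mathcomp Require Import all_boot all_order all_algebra.
From mathcomp Require Import all_classical all_reals all_analysis.
Set Implicit Arguments. Unset Strict Implicit. Unset Printing Implicit Defensive.
Import Order.TTheory GRing.Theory Num.Theory.
Import numFieldNormedType.Exports.
Local Open Scope classical_set_scope.
Local Open Scope ring_scope.

Definition mconv (R : realType) (m1 m2 : set R -> \bar R) (A : set R) : \bar R :=
  (\int[m1]_x m2 [set y | A (x + y)%R])%E.

(* n-fold convolution power: mconvpow m 0 = m, mconvpow m n = m^{*(n+1)}. *)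
Fixpoint mconvpow (R : realType) (m : set R -> \bar R) (n : nat) : set R -> \bar R :=
  match n with
  | 0%N => m
  | n'.+1 => mconv (mconvpow m n') m
  end.

Definition msupport (R : realType) (m : set R -> \bar R) : set R :=
  [set x | forall e : R, 0 < e -> (0 < m (ball x e))%E].

Definition classC (R : realType) (mu : probability R R) : Prop :=
  forall mu1 : probability R R,
    (forall n : nat, forall A : set R, measurable A -> A `<=` `[0, +oo[ ->
        mconvpow mu1 n A = mconvpow mu n A) ->
    forall A : set R, measurable A -> mu1 A = mu A.

(* Main.v *)
Require Import Defs.
From HB Require Import structures.
From mathcomp Require Import all_boot all_order all_algebra.
From mathcomp Require Import all_classical all_reals all_analysis.
From mathcomp Require Import measurable_realfun ring lra.
Set Implicit Arguments. Unset Strict Implicit. Unset Printing Implicit Defensive.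
Import Order.TTheory GRing.Theory Num.Theory.
Import numFieldNormedType.Exports.
Local Open Scope classical_set_scope.
Local Open Scope ring_scope.

(* For [t > a], Tonelli's theorem turns [\int f(t + s) G(ds)] into
   [\int e^{-ut} LG(u) nu(du)], where [LG] is the Laplace transform of the
   measure [G] on the half-line.  Uniqueness of Laplace transforms then shows
   that two measures [G1], [G2] giving the same value for all [t] have
   [LG1 = LG2] nu-almost everywhere.  Since every neighbourhood of [a_n] has
   positive nu-measure, [LG1] and [LG2] agree on a sequence interlaced with
   [(a_n)], along which the sum of inverses still diverges, and the theorem of
   Muntz gives [G1 = G2].
   For (ii), the restriction of [mu * mu] to the half-line splits into a part
   that only involves the restriction of [mu] to the half-line, and twice a
   cross term of the above form, where [G] is the reflection of the restriction
   of [mu] to the negative half-line. *)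

(** * Approximation by sums of exponentials *)

Section exponential_sums.
Context {R : realType}.
Implicit Types (q s : R) (lam c : nat -> R).

(** The increasing sequence may be bounded, and this shapes the proof of the theorem of Muntz. The
    approximation error for e^{-qs} is the product of the |1 - q / lam_i|; it tends to 0 if q lies
    below all exponents, but tends to infinity if q exceeds twice their supremum. So the exponents q
    in an initial interval (0, b) are obtained from the given sequence, and b is then doubled
    repeatedly, by means of auxiliary exponents accumulating at b. Uniqueness from natural exponents
    is used in both variables: in u, to strip off the integral against [nu], and in s, to finish the
    theorem of Muntz. The use in u compares transforms that may be infinite and yields equality only
    almost everywhere. Finiteness is therefore recorded together with equality, and in (i), where G
    can have infinite mass, a damping factor e^{-cs} is inserted at a point c where the transform is
    finite. *)

Lemma is_derive_expRM (k x : R) :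
  is_derive x 1 (fun s => expR (k * s)) (k * expR (k * x)).
Proof.
apply: is_derive_eq.
by rewrite /GRing.scale /= mulr1 mulrC.
Qed.

(** Replaces integration of the bound on [dP]: for e = 1 and e = -1 the function
    [K / lam * expR (lam * x) - e * P x] has a nonnegative derivative on the half-line, and the mean
    value theorem compares it with its value at 0. *)
Lemma gt0_derive_expR_bound (P dP : R -> R) (K lam : R) : 0 < lam ->
  (forall x : R, is_derive x 1 P (dP x)) -> P 0 = 0 ->
  (forall x, 0 <= x -> `|dP x| <= K * expR (lam * x)) ->
  forall s, 0 <= s -> `|P s| <= K / lam * expR (lam * s).
Proof.
move=> lam0 P' P0 dPK.
have mono (e : R) : `|e| = 1 ->
    forall s, 0 <= s -> e * P s <= K / lam * expR (lam * s).
  move=> e1 s; rewrite le_eqVlt => /predU1P[<-|s0].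
    rewrite P0 !mulr0 expR0 mulr1 divr_ge0 ?(ltW lam0)//.
    by have := dPK 0 (lexx _); rewrite mulr0 expR0 mulr1; apply: le_trans.
  pose G (x : R) := K / lam * expR (lam * x) - e * P x.
  have G' (x : R) : is_derive x 1 G (K * expR (lam * x) - e * dP x).
    have H1 := is_derive_expRM lam x.
    apply: is_derive_eq.
    by rewrite /GRing.scale /=; field; rewrite gt_eqF.
  have [c /[!in_itv]/= /andP[c0 _]] : exists2 c, c \in `]0, s[%R &
      G s - G 0 = (K * expR (lam * c) - e * dP c) * (s - 0).
    apply: MVT => //.
    by apply: derivable_within_continuous => x _; exact: ex_derive.
  have K0 : 0 <= K.
    by have := dPK 0 (lexx _); rewrite mulr0 expR0 mulr1; apply: le_trans.
  have h : 0 <= (K * expR (lam * c) - e * dP c) * (s - 0).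
    rewrite mulr_ge0 ?subr_ge0 ?(ltW s0)//.
    rewrite (le_trans (ler_norm _))// normrM e1 mul1r.
    by rewrite dPK// ltW.
  move=> E; move: h; rewrite -E /G P0 !mulr0 expR0 mulr1 subr0.
  have : 0 <= K / lam by rewrite divr_ge0// ltW.
  lra.
move=> s s0; rewrite ler_norml.
have h1 := mono 1 (normr1 _) s s0.
have h2 := mono (-1) (etrans (normrN1 _) erefl) s s0.
by apply/andP; split; lra.
Qed.

(* von Golitschek's proof of the Muntz theorem: the approximants Q_n of
   e^{-qs} are obtained by solving Q_{n+1}' = - lam_n Q_{n+1} + (lam_n - q) Q_n
   with Q_{n+1}(0) = 0, starting from Q_0 = e^{-qs}. *)
Lemma expR_approx_prod q lam : 0 < q -> injective lam ->
  (forall i, 0 < lam i) -> (forall i, lam i != q) ->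
  forall n, exists c, forall s, 0 <= s ->
    `|expR (- (q * s)) - \sum_(i < n) c i * expR (- (lam i * s))|
      <= \prod_(i < n) `|1 - q / lam i|.
Proof.
move=> q0 ilam lam0 lamq; elim=> [|n [c cn]].
  exists (fun=> 0) => s s0; rewrite !big_ord0 subr0 ger0_norm ?expR_ge0//.
  by rewrite expR_le1 oppr_le0 mulr_ge0// ltW.
pose l := lam n.
(* The integrating factor e^{ls} turns the equation into P' = (l - q) e^{ls} Q_n for P = e^{ls}
   Q_{n+1}. Integrating term by term gives the [d i], and P(0) = 0 fixes the coefficient of the new
   exponential. *)
pose d i := c i * (l - q) / (l - lam i).
exists (fun i => if (i < n)%N then d i else 1 - \sum_(j < n) d j) => s s0.
rewrite !big_ord_recr /= ltnn.
under eq_bigr do rewrite ltn_ord.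
set M := \prod_(i < n) _ in cn *.
pose P (x : R) := expR ((l - q) * x) - 1
  - \sum_(i < n) d i * (expR ((l - lam i) * x) - 1).
pose dP (x : R) := (l - q) * expR (l * x) *
  (expR (- (q * x)) - \sum_(i < n) c i * expR (- (lam i * x))).
have PE x : P x = expR (l * x) * (expR (- (q * x)) -
    (\sum_(i < n) d i * expR (- (lam i * x)) +
     (1 - \sum_(j < n) d j) * expR (- (l * x)))).
  rewrite mulrBr mulrDr mulrCA -!expRD subrr expR0 mulr1 mulr_sumr.
  rewrite /P -mulrBl.
  have -> : \sum_(i < n) d i * (expR ((l - lam i) * x) - 1) =
     \sum_(i < n) expR (l * x) * (d i * expR (- (lam i * x))) -
     \sum_(i < n) d i.
    rewrite -sumrB; apply: eq_bigr => i _.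
    by rewrite mulrCA -expRD -mulrBl mulrBr mulr1.
  ring.
have P' (x : R) : is_derive x 1 P (dP x).
  have -> : P = (fun x => expR ((l - q) * x)) - cst 1 -
      \sum_(i < n) d i *: ((fun x => expR ((l - lam i) * x)) - cst 1).
    by apply/funext => y; rewrite /P !fctE fct_sumE.
  have H0 := is_derive_expRM (l - q) x.
  have H1 (i : 'I_n) : is_derive x 1
     (d i *: ((fun x => expR ((l - lam i) * x)) - cst 1))
     (d i *: ((l - lam i) * expR ((l - lam i) * x))).
    have H2 := is_derive_expRM (l - lam i) x.
    by apply: is_derive_eq; rewrite subr0.
  have H3 := is_derive_sum H1.
  apply: is_derive_eq; rewrite /dP subr0 mulrBr; congr (_ - _).
    by rewrite -mulrA -expRD -mulrBl.
  rewrite mulr_sumr; apply: eq_bigr => i _.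
  rewrite /d /GRing.scale/=.
  have -> : expR ((l - lam i) * x) = expR (l * x) * expR (- (lam i * x)).
    by rewrite -expRD mulrBl.
  field.
  by rewrite subr_eq0; apply/eqP => /ilam /eqP; rewrite gtn_eqF.
have P0 : P 0 = 0.
  rewrite /P !mulr0 expR0 subrr big1 ?subr0// => i _.
  by rewrite mulr0 expR0 subrr mulr0.
have dPb x : 0 <= x -> `|dP x| <= (`|l - q| * M) * expR (l * x).
  move=> x0; rewrite /dP !normrM (ger0_norm (expR_ge0 _)) -mulrA -[leRHS]mulrA.
  by rewrite ler_wpM2l// mulrC ler_wpM2r ?expR_ge0// cn.
have := gt0_derive_expR_bound (lam0 n) P' P0 dPb s0.
rewrite PE normrM (ger0_norm (expR_ge0 _)) mulrC ler_pM2r ?expR_gt0//.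
move=> /le_trans; apply; rewrite mulrAC mulrC ler_wpM2l//.
  by apply: prodr_ge0 => i _.
by rewrite -[X in _ / X](gtr0_norm (lam0 n)) -normf_div mulrBl divff// gt_eqF// lam0.
Qed.

(** From 1 - x <= e^{-x}, the factors being positive because [q] lies below every [lam i]. A
    divergent sum of inverses thus sends the product to 0. *)
Lemma prod_le_expR_sum q lam n : 0 < q -> (forall i, q < lam i) ->
  \prod_(i < n) `|1 - q / lam i| <= expR (- (q * \sum_(i < n) (lam i)^-1)).
Proof.
move=> q0 ql; have l0 i : 0 < lam i by rewrite (lt_trans q0).
rewrite mulr_sumr -sumrN expR_sum; apply: ler_prod => i _; rewrite normr_ge0/=.
rewrite ger0_norm; first exact: expR_ge1Dx.
by rewrite subr_ge0 ler_pdivrMr// mul1r ltW.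
Qed.

(* The factor [n] in the exponent makes the limit exactly the indicator of
   [u > b], including at [u = b]. *)
Definition ray_approx (b : R) (n : nat) (u : R) : R :=
  (1 - expR (- u) ^+ n) ^+ Num.truncn (n%:R * expR (n%:R * b)).

Lemma ray_approx_horner b n :
  exists p : {poly R}, ray_approx b n = (fun u => p.[expR (- u)]).
Proof.
exists ((1 - 'X^n) ^+ Num.truncn (n%:R * expR (n%:R * b))).
by apply/funext => u; rewrite /ray_approx !hornerE.
Qed.

Lemma ray_approx_itv b n u : 0 <= u -> 0 <= ray_approx b n u <= 1.
Proof.
move=> u0; have e1 : expR (- u) ^+ n <= 1.
  by rewrite exprn_ile1 ?expR_ge0// expR_le1 oppr_le0.
rewrite /ray_approx exprn_ge0 ?subr_ge0//= exprn_ile1 ?subr_ge0//.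
Qed.

Lemma ler_1BMn_exprn (y : R) (n : nat) : 0 <= y <= 1 ->
  1 - n%:R * y <= (1 - y) ^+ n.
Proof.
move=> /andP[y0 y1]; elim: n => [|n ih]; first by rewrite mul0r subr0 expr0.
rewrite exprS; apply: le_trans (_ : (1 - y) * (1 - n%:R * y) <= _).
  rewrite -natr1; have : 0 <= n%:R * (y * y) by rewrite !mulr_ge0.
  lra.
by rewrite ler_wpM2l// subr_ge0.
Qed.

(** With y = e^{-nu} and K the outer exponent, K y is of order n e^{n(b-u)}, which tends to 0 for u
    > b and to infinity for u <= b; and (1 - y)^K lies between 1 - K y and e^{-K y}. *)
Lemma cvg_ray_approx b u : 0 <= u ->
  ray_approx b n u @[n --> \oo] --> (\1_(`]b, +oo[%classic) u : R).
Proof.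
move=> u0; rewrite -cvg_shiftS.
have harm : @harmonic R @ \oo --> (0 : R) := @cvg_harmonic R.
have eS n : expR (- u) ^+ n = expR (- (n%:R * u)) by rewrite -expRM_natl mulrN.
have y01 n : 0 <= expR (- u) ^+ n <= 1.
  by rewrite exprn_ge0 ?expR_ge0//= exprn_ile1 ?expR_ge0// expR_le1 oppr_le0.
have [bu|ub] := ltP b u.
  rewrite indicE mem_set//=; last by rewrite in_itv/= bu.
  pose d := u - b; have d0 : 0 < d by rewrite subr_gt0.
  apply: (@squeeze_cvgr _ _ _ _ (fun n => 1 - 4 / d ^+ 2 * harmonic n) (cst 1)).
  - near=> n; have /andP[_ ->] := ray_approx_itv b n.+1 u0; rewrite andbT.
    apply: le_trans (ler_1BMn_exprn _ (y01 _)); rewrite lerD2l lerN2 eS.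
    set N := n.+1%:R : R.
    have N0 : 0 < N by rewrite ltr0n.
    apply: (@le_trans _ _ (N * expR (N * b) * expR (- (N * u)))).
      by rewrite ler_wpM2r ?expR_ge0// truncn_le mulr_ge0 ?expR_ge0// ltW.
    rewrite -mulrA -expRD -mulrBr -opprB -/d mulrN expRN.
    (* Squaring this gives e^{Nd} >= (Nd/2)^2, whence the constant 4 / d^2. The linear bound on
       e^{Nd} would only keep N e^{-Nd} bounded. *)
    have : N * d / 2 <= expR (N * d / 2).
      by rewrite (le_trans _ (expR_ge1Dx _))// lerDr.
    have Nd : 0 <= N * d / 2 by rewrite divr_ge0// mulr_ge0 ?ltW.
    move=> /(fun h => ler_pM Nd Nd h h); rewrite -expRD -splitr => h.
    rewrite /harmonic/= -/N ler_pdivrMr ?expR_gt0//.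
    have -> : 4 / d ^+ 2 / N * expR (N * d) =
      N * (expR (N * d) / (N * d / 2 * (N * d / 2))).
      by field; rewrite !gt_eqF.
    rewrite ler_peMr ?(ltW N0)// ler_pdivlMr ?mul1r//.
    by rewrite !mulr_gt0.
  - rewrite -[X in _ --> X]subr0 -[X in _ - X](mulr0 (4 / d ^+ 2)).
    by apply: cvgB; [exact: cvg_cst|apply: cvgMr].
  - exact: cvg_cst.
rewrite indicE memNset//=; last by rewrite in_itv/= andbT; apply/negP; rewrite -leNgt.
apply: (@squeeze_cvgr _ _ _ _ (cst 0) (@harmonic R)) => //; last exact: cvg_cst.
near=> n; have /andP[-> _]/= := ray_approx_itv b n.+1 u0.
rewrite /ray_approx eS; set N := n.+1%:R : R; set K := Num.truncn _.
have N1 : 1 <= N by rewrite ler1n.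
have y1 : 0 <= expR (- (N * u)) <= 1 by rewrite /N -eS y01.
apply: (@le_trans _ _ (expR (- (K%:R * expR (- (N * u)))))).
  rewrite -(mulrN K%:R) expRM_natl lerXn2r ?nnegrE ?expR_ge0//.
  - by case/andP: y1; lra.
  - exact: expR_ge1Dx.
(* Truncation costs at most 1 in [K], hence at most e^{-Nu} <= 1 in K e^{-Nu}; the 1 in e^x >= 1 + x
   absorbs this loss. *)
have hK : N * expR (N * b) - 1 <= K%:R.
  by rewrite lerBlDr natr1 ltW// truncnS_gt.
rewrite expRN /harmonic /= -/N lef_pV2 ?posrE ?expR_gt0 ?ltr0n//.
apply: le_trans (expR_ge1Dx _).
apply: (@le_trans _ _ (1 + (N * expR (N * b) - 1) * expR (- (N * u)))).
  rewrite mulrBl mul1r -mulrA -expRD -mulrBr.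
  have h : 1 <= expR (N * (b - u)).
    by rewrite -expR0 ler_expR mulr_ge0 ?subr_ge0// (le_trans _ N1).
  have : N * 1 <= N * expR (N * (b - u)) by rewrite ler_wpM2l// (le_trans _ N1).
  by case/andP: y1; lra.
by rewrite lerD2l ler_wpM2r//; case/andP: y1.
Unshelve. all: by end_near. Qed.

End exponential_sums.

(** * Uniqueness of Laplace transforms and the theorem of Muntz *)

Lemma fin_num_addeI (R : realType) (x y z : \bar R) :
  x \is a fin_num -> (x + y = x + z -> y = z)%E.
Proof.
move=> xfin E.
by rewrite -(addeK y xfin) -(addeK z xfin) (addeC y) E (addeC z).
Qed.

Section weighted_integral.
Context {R : realType}.
Variables (m : {measure set R -> \bar R}) (D : set R) (f : R -> R).
Hypotheses (mD : measurable D) (fi : m.-integrable D (EFin \o f)).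
Hypothesis f0 : forall x, D x -> 0 <= f x.
Implicit Types Q P : R -> R.

(** Test functions: boundedness keeps their products with the integrable density [f] integrable, so
    that [wint] is linear on them. *)
Definition bounded_mfun Q :=
  measurable_fun D Q /\ exists M, forall x, D x -> `|Q x| <= M.

Definition wint Q : R := \int[m]_(x in D) (Q x * f x).

Lemma bounded_mfunM Q P :
  bounded_mfun Q -> bounded_mfun P -> bounded_mfun (fun x => Q x * P x).
Proof.
move=> [mQ [M QM]] [mP [N PN]]; split; first exact: measurable_funM.
by exists (M * N) => x Dx; rewrite normrM ler_pM// ?QM ?PN.
Qed.

Lemma bounded_mfunD Q P :
  bounded_mfun Q -> bounded_mfun P -> bounded_mfun (fun x => Q x + P x).
Proof.
move=> [mQ [M QM]] [mP [N PN]]; split; first exact: measurable_funD.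
by exists (M + N) => x Dx; rewrite (le_trans (ler_normD _ _))// lerD// ?QM ?PN.
Qed.

Lemma bounded_mfun_cst (c : R) : bounded_mfun (cst c).
Proof. by split; [exact: measurable_cst|exists `|c|]. Qed.

Lemma bounded_mfun_sum n (Q : nat -> R -> R) :
  (forall i, bounded_mfun (Q i)) -> bounded_mfun (fun x => \sum_(i < n) Q i x).
Proof.
move=> bQ; elim: n => [|n ih].
  by under eq_fun do rewrite big_ord0; exact: bounded_mfun_cst.
by under eq_fun do rewrite big_ord_recr /=; exact: bounded_mfunD.
Qed.

Lemma integrable_bounded_mfunM Q : bounded_mfun Q ->
  m.-integrable D (EFin \o (fun x => Q x * f x)).
Proof.
move=> [mQ [M QM]].
have mf : measurable_fun D f by apply/measurable_EFinP; exact: measurable_int fi.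
apply: (@le_integrable _ _ _ m D mD _ (fun x => M%:E * (EFin \o f) x)%E).
- by apply/measurable_EFinP; exact: measurable_funM.
- move=> x Dx; rewrite lee_fin /= !normrM.
  by rewrite ler_wpM2r// (le_trans (QM _ Dx))// ler_norm.
- exact: integrableZl.
Qed.

Lemma wintD Q P : bounded_mfun Q -> bounded_mfun P ->
  wint (fun x => Q x + P x) = wint Q + wint P.
Proof.
move=> bQ bP; rewrite /wint -RintegralD//; [|exact: integrable_bounded_mfunM..].
by apply: eq_Rintegral => x _; rewrite mulrDl.
Qed.

Lemma wintZ (c : R) Q : bounded_mfun Q ->
  wint (fun x => c * Q x) = c * wint Q.
Proof.
move=> bQ; rewrite /wint -RintegralZl//; last exact: integrable_bounded_mfunM.
by apply: eq_Rintegral => x _; rewrite mulrA.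
Qed.

Lemma wint_sum n (c : nat -> R) (Q : nat -> R -> R) :
  (forall i, bounded_mfun (Q i)) ->
  wint (fun x => \sum_(i < n) c i * Q i x) = \sum_(i < n) c i * wint (Q i).
Proof.
move=> bQ; have bcQ i : bounded_mfun (fun x => c i * Q i x).
  exact: (bounded_mfunM (bounded_mfun_cst _)).
elim: n => [|n ih].
  rewrite big_ord0; under eq_fun do rewrite big_ord0.
  rewrite /wint; under eq_Rintegral do rewrite mul0r.
  by rewrite Rintegral_cst// mul0r.
rewrite big_ord_recr /= -ih -wintZ// -wintD//.
  by under eq_fun do rewrite big_ord_recr.
exact: (@bounded_mfun_sum n (fun i x => c i * Q i x)).
Qed.

Lemma wint_le Q (M : R) : bounded_mfun Q ->
  (forall x, D x -> `|Q x| <= M) -> `|wint Q| <= M * \int[m]_(x in D) f x.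
Proof.
move=> bQ QM; rewrite (le_trans (le_normr_Rintegral _ _))//.
  exact: integrable_bounded_mfunM.
rewrite -RintegralZl//; apply: le_Rintegral => //.
- have := integrable_norm (integrable_bounded_mfunM bQ).
  by apply: eq_integrable.
- exact: (integrable_bounded_mfunM (bounded_mfun_cst M)).
- by move=> x Dx; rewrite normrM (ger0_norm (f0 Dx)) ler_wpM2r ?f0// QM.
Qed.

Hypothesis D0 : D `<=` `[0, +oo[.

Lemma bounded_mfun_expRN (z : R) : 0 <= z ->
  bounded_mfun (fun x => expR (- (z * x))).
Proof.
move=> z0; split.
  apply: measurable_funTS; apply: measurableT_comp => //.
  by apply: measurableT_comp => //; exact: measurable_funM.
exists 1 => x /D0 /=; rewrite in_itv/= andbT => x0.
by rewrite ger0_norm ?expR_ge0// expR_le1 oppr_le0 mulr_ge0.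
Qed.

Lemma bounded_mfun_poly (p : {poly R}) :
  bounded_mfun (fun x => p.[expR (- x)]).
Proof.
elim/poly_ind: p => [|p c bp].
  by under eq_fun do rewrite horner0; exact: bounded_mfun_cst.
under eq_fun do rewrite hornerMXaddC.
apply: bounded_mfunD; last exact: bounded_mfun_cst.
apply: bounded_mfunM => //.
by have := bounded_mfun_expRN ler01; under eq_fun do rewrite mul1r.
Qed.

(** Dominated convergence, with [f] itself as the dominating function since [ray_approx] stays in
    [0, 1]. *)
Lemma cvg_wint_ray_approx (b : R) :
  wint (ray_approx b n) @[n --> \oo] --> \int[m]_(x in D `&` `]b, +oo[) f x.
Proof.
have mf : measurable_fun D f by apply/measurable_EFinP; exact: measurable_int fi.
have mr n : measurable_fun D (ray_approx b n).
  have [p ->] := ray_approx_horner b n.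
  by case: (bounded_mfun_poly p).
have mi : measurable_fun D (fun x => \1_(`]b, +oo[%classic) x : R).
  by apply: measurable_funTS; exact: measurable_indic.
have [] := @dominated_convergence _ _ _ m D mD
  (fun n x => (ray_approx b n x * f x)%:E)
  (fun x => (\1_(`]b, +oo[%classic) x * f x)%:E) (EFin \o f).
- by move=> n; apply/measurable_EFinP; exact: measurable_funM.
- by apply/measurable_EFinP; exact: measurable_funM.
- apply: aeW => x /D0 /=; rewrite in_itv/= andbT => x0.
  apply: cvg_EFin; first exact: nearW.
  by apply: cvgMl; exact: cvg_ray_approx.
- exact: fi.
- apply: aeW => x n Dx; have /= := D0 Dx; rewrite in_itv/= andbT => x0.
  rewrite lee_fin normrM (ger0_norm (f0 Dx)).
  have /andP[r0 r1] := ray_approx_itv b n x0.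
  by rewrite ger0_norm// ler_piMl// f0.
move=> iind _; rewrite -[X in _ --> X -> _](fineK (integrable_fin_num mD iind)).
move=> /fine_cvgP[_]; rewrite /wint /Rintegral integral_mkcondr.
rewrite (_ : (fun x => (\1_(`]b, +oo[%classic) x * f x)%:E) =
  (EFin \o f) \_ `]b, +oo[)//.
by apply/funext => x; rewrite patchE indicE; case: ifP => _; rewrite ?mul1r ?mul0r.
Qed.

End weighted_integral.

Section weighted_integral_eq.
Context {R : realType}.
Variables (m1 m2 : {measure set R -> \bar R}) (D : set R) (f1 f2 : R -> R).
Hypotheses (mD : measurable D) (D0 : D `<=` `[0, +oo[).
Hypotheses (fi1 : m1.-integrable D (EFin \o f1))
           (fi2 : m2.-integrable D (EFin \o f2)).
Hypotheses (f01 : forall x, D x -> 0 <= f1 x)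
           (f02 : forall x, D x -> 0 <= f2 x).

Let mf1 : measurable_fun D (EFin \o f1). Proof. exact: measurable_int fi1. Qed.
Let mf2 : measurable_fun D (EFin \o f2). Proof. exact: measurable_int fi2. Qed.

(** Both the measure and the density may differ between the two sides: (i) compares two densities
    against Lebesgue measure, (ii) two reflected probabilities with constant density 1. *)
Local Notation same Q := (wint m1 D f1 Q = wint m2 D f2 Q).

(** Open rays form a pi-system generating the Borel sets, and the sets with equal integrals form a
    Dynkin system; integrability permits the subtraction needed for complements. *)
Lemma eq_integral_of_rays :
  (forall b : R, (\int[m1]_(x in D `&` `]b, +oo[) (f1 x)%:E =
                  \int[m2]_(x in D `&` `]b, +oo[) (f2 x)%:E)%E) ->
  forall A, measurable A -> A `<=` D ->
  (\int[m1]_(x in A) (f1 x)%:E = \int[m2]_(x in A) (f2 x)%:E)%E.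
Proof.
move=> rays A mA AD.
have ssI B : D `&` B `<=` D by exact: subIsetl.
have DT : (\int[m1]_(x in D) (f1 x)%:E = \int[m2]_(x in D) (f2 x)%:E)%E.
  (* [D] lies in the nonnegative half-line, so the ray from -1 contains it. *)
  have := rays (-1); congr (_ = _); congr (integral _ _ _);
    apply/setIidPl => x /D0 /=; rewrite !in_itv/= !andbT; exact: lt_le_trans.
suff : (\int[m1]_(x in D `&` A) (f1 x)%:E =
        \int[m2]_(x in D `&` A) (f2 x)%:E)%E by rewrite setIidr.
have finI (m : {measure set R -> \bar R}) (f : R -> R) :
    m.-integrable D (EFin \o f) -> forall B, measurable B ->
    (\int[m]_(x in D `&` B) (f x)%:E)%E \is a fin_num.
  move=> fi B mB; apply: integrable_fin_num => //; first exact: measurableI.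
  by apply: integrableS fi => //; exact: measurableI.
have mGE := RGenOInfty.measurableE R.
apply: (@dynkin_induction _ _ (@RGenOInfty.G R)
  [set A | (\int[m1]_(x in D `&` A) (f1 x)%:E =
            \int[m2]_(x in D `&` A) (f2 x)%:E)%E]) => //.
- move=> _ _ [a ->] [b ->]; exists (Num.max a b).
  apply/seteqP; split=> x /=; rewrite !in_itv/= !andbT gt_max.
    by move=> [-> ->].
  by move=> /andP[-> ->].
- by rewrite /= setIT.
- by move=> _ [b ->] /=; exact: rays.
- move=> S mS /= SE.
  have split (m : {measure set R -> \bar R}) (f : R -> R) :
      measurable_fun D (EFin \o f) ->
      (\int[m]_(x in D) (f x)%:E = \int[m]_(x in D `&` S) (f x)%:E +
         \int[m]_(x in D `&` ~` S) (f x)%:E)%E.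
    move=> mf; rewrite -integral_setU//=.
    + by rewrite -setIUr setUv setIT.
    + exact: measurableI.
    + by apply: measurableI => //; exact: measurableC.
    + by rewrite -setIUr setUv setIT.
    + by rewrite disj_set2E; apply/eqP; rewrite setIACA setICr setI0.
  have := DT; rewrite (split _ _ mf1) (split _ _ mf2) SE.
  by apply: fin_num_addeI; exact: finI.
- move=> F mF tF PF /=; rewrite setI_bigcupr.
  have mDF k : measurable (D `&` F k) by exact: measurableI.
  have tDF : trivIset [set: nat] (fun k => D `&` F k) by exact: trivIset_setIl tF.
  have sub : \bigcup_i (D `&` F i) `<=` D by move=> x [i _ []].
  rewrite !ge0_integral_bigcup//=.
  + by apply: eq_eseriesr => k _; exact: PF.
  + exact: measurable_funS mf2.
  + by move=> x /sub /f02; rewrite lee_fin.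
  + exact: measurable_funS mf1.
  + by move=> x /sub /f01; rewrite lee_fin.
- by rewrite -[<<s _ >>]mGE.
Qed.

(** Natural exponents give every polynomial in e^{-x}, hence each [ray_approx], and in the limit the
    rays. *)
Lemma eq_integral_of_expRN_nat :
  (forall k : nat, same (fun x => expR (- (k%:R * x)))) ->
  forall A, measurable A -> A `<=` D ->
  (\int[m1]_(x in A) (f1 x)%:E = \int[m2]_(x in A) (f2 x)%:E)%E.
Proof.
move=> same_expRN; apply: eq_integral_of_rays => b.
have same_poly (p : {poly R}) : same (fun x => p.[expR (- x)]).
  have e0 (i : nat) := @bounded_mfun_expRN R D D0 _ (ler0n R i).
  have hp (x : R) : p.[expR (- x)] = \sum_(i < size p) p`_i * expR (- (i%:R * x)).
    by rewrite horner_coef; apply: eq_bigr => i _; rewrite -expRM_natl mulrN.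
  under eq_fun do rewrite hp.
  rewrite !(@wint_sum _ _ _ _ _ _ _ (fun i => p`_i)
    (fun i x => expR (- (i%:R * x))))//.
  by apply: eq_bigr => i _; rewrite same_expRN.
have h1 := cvg_wint_ray_approx mD fi1 f01 D0 (b := b).
have h2 := cvg_wint_ray_approx mD fi2 f02 D0 (b := b).
have E : (fun n => wint m1 D f1 (ray_approx b n)) =
         (fun n => wint m2 D f2 (ray_approx b n)).
  apply/funext => n.
  by have [p ->] := ray_approx_horner b n; exact: same_poly.
rewrite E in h1.
have := cvg_unique _ h1 h2; rewrite /Rintegral => Eb.
have fin (m : {measure set R -> \bar R}) (f : R -> R) :
    m.-integrable D (EFin \o f) ->
    (\int[m]_(x in D `&` `]b, +oo[) (f x)%:E)%E \is a fin_num.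
  move=> fi; apply: integrable_fin_num; first exact: measurableI.
  by apply: integrableS fi => //; exact: measurableI.
by rewrite -(fineK (fin _ _ fi1)) -(fineK (fin _ _ fi2)) Eb.
Qed.

(** The approximating combination has the same integral on both sides, so only the uniform
    approximation error remains, multiplied by the total masses collected in [K]. *)
Lemma same_expRN_prod (q : R) (lam : nat -> R) : 0 < q -> injective lam ->
  (forall i, 0 < lam i) -> (forall i, lam i != q) ->
  (forall i, same (fun x => expR (- (lam i * x)))) ->
  (forall e, 0 < e -> exists n, \prod_(i < n) `|1 - q / lam i| < e) ->
  same (fun x => expR (- (q * x))).
Proof.
move=> q0 ilam lam0 lamq slam small.
pose K := \int[m1]_(x in D) f1 x + \int[m2]_(x in D) f2 x.
have K0 : 0 <= K by rewrite addr_ge0 ?Rintegral_ge0.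
apply/eqP; rewrite -subr_eq0 -normr_le0; apply/ler_addgt0Pr => e e0.
rewrite add0r.
(* Dividing by [K + 1] covers the case [K = 0]. *)
have [|n hn] := small (e / (K + 1)); first by rewrite divr_gt0// ltr_wpDl.
have [c cb] := expR_approx_prod q0 ilam lam0 lamq n.
pose Q (x : R) := expR (- (q * x)) + \sum_(i < n) (- c i) * expR (- (lam i * x)).
have el i := @bounded_mfun_expRN R D D0 _ (ltW (lam0 i)).
have eq_ := @bounded_mfun_expRN R D D0 _ (ltW q0).
have bs : bounded_mfun D (fun x => \sum_(i < n) (- c i) * expR (- (lam i * x))).
  apply: (@bounded_mfun_sum _ _ n (fun i x => (- c i) * expR (- (lam i * x)))) => i.
  exact: bounded_mfunM (bounded_mfun_cst _ _) (el i).
have bQ : bounded_mfun D Q by exact: bounded_mfunD.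
have QE (m : {measure set R -> \bar R}) (f : R -> R) :
    m.-integrable D (EFin \o f) ->
    wint m D f Q = wint m D f (fun x => expR (- (q * x))) +
      \sum_(i < n) (- c i) * wint m D f (fun x => expR (- (lam i * x))).
  move=> fi; rewrite /Q wintD//; congr (_ + _).
  exact: (@wint_sum _ _ _ _ _ _ n (fun i => - c i) (fun i x => expR (- (lam i * x)))).
have QM x : D x -> `|Q x| <= \prod_(i < n) `|1 - q / lam i|.
  move=> /D0/=; rewrite in_itv/= andbT => /cb; rewrite -sumrN.
  by under [in X in X -> _]eq_bigr do rewrite -mulNr.
have -> : wint m1 D f1 (fun x => expR (- (q * x))) -
    wint m2 D f2 (fun x => expR (- (q * x))) = wint m1 D f1 Q - wint m2 D f2 Q.
  rewrite !QE//.
  under [X in _ = _ - (_ + X)]eq_bigr do rewrite -slam.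
  by rewrite opprD addrACA subrr addr0.
apply: le_trans (ler_normB _ _) _.
apply: le_trans (lerD (wint_le mD fi1 f01 bQ QM) (wint_le mD fi2 f02 bQ QM)) _.
rewrite -mulrDr -/K; apply: le_trans (_ : e / (K + 1) * K <= e).
  by rewrite ler_wpM2r// ltW.
rewrite -mulrA ler_piMr ?(ltW e0)// mulrC ler_pdivrMr ?ltr_wpDl// mul1r.
by rewrite lerDl.
Qed.

(** For b <= q < 2b, exponents increasing to b are used: once they stay above a bound larger than
    q/2, the factors |1 - q / lam_i| are at most some rho < 1 and the products decay
    geometrically. *)
Lemma same_expRN_double (b : R) :
  (forall q, 0 < q -> q < b -> same (fun x => expR (- (q * x)))) ->
  forall q, 0 < q -> q < 2 * b -> same (fun x => expR (- (q * x))).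
Proof.
move=> same_b q q0 q2b; have [qb|bq] := ltP q b; first exact: same_b.
have b0 : 0 < b by lra.
pose d := b - q / 2.
have d0 : 0 < d by rewrite /d; lra.
(* [i.+2] puts [lam 0] at the midpoint of q/2 and b; with [i.+1] it would be q/2 itself, where the
   factor has absolute value 1. *)
pose lam (i : nat) := b - d / i.+2%:R.
have i20 (i : nat) : 0 < i.+2%:R :> R by rewrite ltr0n.
have lamb i : lam i < b by rewrite ltrBlDr ltrDl divr_gt0.
have lam0 i : lam 0%N <= lam i.
  by rewrite lerD2l lerN2 ler_wpM2l ?(ltW d0)// lef_pV2 ?posrE// ler_nat.
have qlam0 : q / 2 < lam 0%N by rewrite /lam /d; lra.
have lam_gt0 i : 0 < lam i.
  by rewrite (lt_le_trans _ (lam0 i))// (le_lt_trans _ qlam0)// divr_ge0// ltW.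
pose rho := q / lam 0%N - 1.
have rho_itv : 0 <= rho < 1.
  rewrite subr_ge0 ler_pdivlMr// mul1r ltrBlDr ltr_pdivrMr//.
  by rewrite (le_trans (ltW (lamb _)))//=; lra.
apply: (@same_expRN_prod _ lam) => //.
- move=> i j /addrI/oppr_inj/mulfI-/(_ (lt0r_neq0 d0))/invr_inj/eqP.
  by rewrite eqr_nat => /eqP[].
- by move=> i; rewrite lt_eqF// (lt_le_trans (lamb i)).
- by move=> i; apply: same_b.
- move=> e e0.
  have /cvgrPdist_lt/(_ _ e0)[n _ /(_ n (leqnn _))/=] :
      rho ^+ n @[n --> \oo] --> (0 : R).
    by apply: cvg_expr; rewrite ger0_norm; case/andP: rho_itv.
  rewrite sub0r normrN => hn; exists n; rewrite (le_lt_trans _ hn)//.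
  rewrite (le_trans _ (ler_norm _))// -[X in _ <= _ ^+ X]card_ord -prodr_const.
  apply: ler_prod => i _; rewrite normr_ge0/= ler0_norm.
    by rewrite opprB /rho lerD2r ler_wpM2l ?(ltW q0)// lef_pV2 ?posrE.
  by rewrite subr_le0 ler_pdivlMr// mul1r (le_trans (ltW (lamb _))).
Qed.

Lemma same_expRN_all (b : R) : 0 < b ->
  (forall q, 0 < q -> q < b -> same (fun x => expR (- (q * x)))) ->
  forall q, 0 < q -> same (fun x => expR (- (q * x))).
Proof.
move=> b0 same_b q q0.
have same_n n : forall q, 0 < q -> q < 2 ^+ n * b ->
    same (fun x => expR (- (q * x))).
  elim: n => [|n ih]; first by rewrite expr0 mul1r.
  by rewrite exprS -mulrA; exact: same_expRN_double.
apply: (same_n (Num.truncn (q / b)).+1) => //.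
rewrite -ltr_pdivrMr// (lt_le_trans (truncnS_gt _))//.
by rewrite -natrX ler_nat ltnW// ltn_expl.
Qed.

(** Below [lam 0] the products tend to 0 because the sum of inverses diverges; doubling extends this
    range to all positive exponents, and together with exponent 0 it contains the natural
    numbers. *)
Theorem muntz (lam : nat -> R) : (forall i, 0 < lam i) ->
  (forall i, lam i < lam i.+1) ->
  (forall M, exists n, M <= \sum_(i < n) (lam i)^-1) ->
  same (fun x => expR (- (0 * x))) ->
  (forall i, same (fun x => expR (- (lam i * x)))) ->
  forall A, measurable A -> A `<=` D ->
  (\int[m1]_(x in A) (f1 x)%:E = \int[m2]_(x in A) (f2 x)%:E)%E.
Proof.
move=> lam0 lamS lamoo same0 same_lam.
have lam_homo : {homo lam : i j / (i < j)%N >-> i < j}.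
  by apply: homo_ltn lamS => ? ? ?; exact: lt_trans.
apply: eq_integral_of_expRN_nat => -[//|k].
apply: (same_expRN_all (lam0 0%N)); last by rewrite ltr0n.
move=> q q0 ql.
have qlam i : q < lam i.
  by case: i => // i; rewrite (lt_trans ql)// lam_homo.
apply: (@same_expRN_prod _ lam) => //.
- by move=> i j E; case: (ltngtP i j) => // /lam_homo; rewrite E ltxx.
- by move=> i; rewrite gt_eqF.
(* With this threshold q times the sum is at least 1/e, so its exponential is at least 1 + 1/e. *)
- move=> e e0; have [n hn] := lamoo (q^-1 * e^-1).
  exists n; rewrite (le_lt_trans (prod_le_expR_sum n q0 qlam))//.
  rewrite expRN -[ltRHS]invrK ltf_pV2 ?posrE ?expR_gt0 ?invr_gt0//.
  rewrite (lt_le_trans _ (expR_ge1Dx _))//.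
  move: hn; rewrite -ler_pdivlMl ?invr_gt0// invrK; lra.
Qed.

End weighted_integral_eq.

(** * Laplace transforms of measures *)

Section tonelli_on_rectangles.
Context {R : realType}.
Variables m1 m2 : {sigma_finite_measure set R -> \bar R}.
Variables (D1 D2 : set R) (k : R * R -> \bar R).
Hypotheses (mD1 : measurable D1) (mD2 : measurable D2).
Hypotheses (mk : measurable_fun setT k) (k0 : forall z, (0 <= k z)%E).

Let kr := k \_ (D1 `*` D2).

Let mkr : measurable_fun setT kr.
Proof.
by apply/(measurable_restrictT _ _).1; [exact: measurableX|exact: measurable_funS mk].
Qed.

Let kr0 z : (0 <= kr z)%E.
Proof. by rewrite /kr patchE; case: ifP. Qed.

Let krE1 x : (\int[m2]_y kr (x, y) =
  ((fun x => \int[m2]_(y in D2) k (x, y)) \_ D1) x)%E.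
Proof.
rewrite patchE; case: ifPn => [|] xD1.
  rewrite [RHS]integral_mkcond; apply: eq_integral => y _; rewrite /kr !patchE.
  by rewrite in_setX xD1.
rewrite integral0_eq// => y _; rewrite /kr patchE in_setX.
by rewrite (negbTE xD1).
Qed.

Let krE2 y : (\int[m1]_x kr (x, y) =
  ((fun y => \int[m1]_(x in D1) k (x, y)) \_ D2) y)%E.
Proof.
rewrite patchE; case: ifPn => [|] yD2.
  rewrite [RHS]integral_mkcond; apply: eq_integral => x _; rewrite /kr !patchE.
  by rewrite in_setX yD2 andbT.
rewrite integral0_eq// => x _; rewrite /kr patchE in_setX.
by rewrite (negbTE yD2) andbF.
Qed.

(** The kernel is extended by 0 outside the rectangle, which reduces the claim to the whole
    plane. *)
Lemma tonelli_on : (\int[m1]_(x in D1) \int[m2]_(y in D2) k (x, y) =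
  \int[m2]_(y in D2) \int[m1]_(x in D1) k (x, y))%E.
Proof.
rewrite [LHS]integral_mkcond [RHS]integral_mkcond.
under eq_integral do rewrite -krE1.
under [RHS]eq_integral do rewrite -krE2.
exact: (fubini_tonelli kr).
Qed.

Lemma measurable_tonelli_on :
  measurable_fun D2 (fun y => \int[m1]_(x in D1) k (x, y))%E.
Proof.
apply/measurable_restrictT => //.
rewrite (_ : _ \_ D2 = fubini_G m1 kr); last by apply/funext => y; rewrite -krE2.
exact: measurable_fun_fubini_tonelli_G.
Qed.

End tonelli_on_rectangles.

Section laplace.
Context {R : realType}.
Implicit Types (rho nu : {sigma_finite_measure set R -> \bar R}).
Implicit Types (D E : set R) (g c : R -> R).

(** Extended-valued, because finiteness is obtained only afterwards and only almost everywhere. *)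
Definition laplace (m : set R -> \bar R) D g (u : R) : \bar R :=
  (\int[m]_(s in D) (expR (- (u * s)) * g s)%:E)%E.

Lemma measurable_laplace rho D E g : measurable D -> measurable E ->
  measurable_fun setT g -> (forall s, 0 <= g s) ->
  measurable_fun E (laplace rho D g).
Proof.
move=> mD mE mg g0.
apply: (@measurable_tonelli_on R rho D E
  (fun z => (expR (- (z.2 * z.1)) * g z.1)%:E)) => //.
  apply/measurable_EFinP; apply: measurable_funM; last exact: measurableT_comp.
  apply: measurableT_comp => //; apply: measurableT_comp => //.
  exact: measurable_funM.
by move=> z; rewrite lee_fin mulr_ge0// expR_ge0.
Qed.

Lemma integral_laplace rho nu D E g c : measurable D -> measurable E ->
  measurable_fun setT g -> (forall s, 0 <= g s) ->
  measurable_fun setT c -> (forall u, 0 <= c u) ->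
  (\int[rho]_(s in D) \int[nu]_(u in E) (c u * (expR (- (u * s)) * g s))%:E =
   \int[nu]_(u in E) ((c u)%:E * laplace rho D g u))%E.
Proof.
move=> mD mE mg g0 mc c0.
pose k (z : R * R) := (c z.2 * (expR (- (z.2 * z.1)) * g z.1))%:E.
have me : measurable_fun setT (fun z : R * R => expR (- (z.2 * z.1)) * g z.1).
  apply: measurable_funM; last exact: measurableT_comp.
  apply: measurableT_comp => //; apply: measurableT_comp => //.
  exact: measurable_funM.
rewrite (@tonelli_on R rho nu D E k)//.
- apply: eq_integral => u _; rewrite /k /= /laplace.
  under eq_integral do rewrite EFinM.
  rewrite ge0_integralZl//.
  + apply/measurable_EFinP; apply: measurable_funTS.
    exact: (@measurableT_comp _ _ _ _ _ _ _ _ (fun s => (s, u)) me).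
  + by move=> s _; rewrite lee_fin mulr_ge0// expR_ge0.
  + by rewrite lee_fin.
- rewrite /k; apply/measurable_EFinP; apply: measurable_funM => //.
  exact: measurableT_comp.
- by move=> z; rewrite lee_fin !mulr_ge0// expR_ge0.
Qed.

End laplace.

Section ae_eq_of_exponential_moments.
Context {R : realType}.
Variables (nu : {measure set R -> \bar R}) (D : set R) (w : R -> R).
Variables (L1 L2 : R -> \bar R).
Hypotheses (mD : measurable D) (D0 : D `<=` `[0, +oo[).
Hypotheses (mw : measurable_fun D w) (w0 : forall u, D u -> 0 < w u).
Hypotheses (mL1 : measurable_fun D L1) (mL2 : measurable_fun D L2).
Hypotheses (L10 : forall u, D u -> (0 <= L1 u)%E)
           (L20 : forall u, D u -> (0 <= L2 u)%E).

Let integrable_wL (L : R -> \bar R) : measurable_fun D L ->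
  (forall u, D u -> (0 <= L u)%E) ->
  (\int[nu]_(u in D) ((w u)%:E * L u) < +oo)%E ->
  nu.-integrable D (fun u => (w u)%:E * L u)%E.
Proof.
move=> mL L0 Loo; apply/integrableP; split.
  by apply: emeasurable_funM => //; exact/measurable_EFinP.
rewrite (eq_integral (fun u => (w u)%:E * L u)%E)// => u /set_mem Du.
by rewrite gee0_abs// mule_ge0 ?L0// lee_fin ltW// w0.
Qed.

Let fine_ae (L : R -> \bar R) : nu.-integrable D (fun u => (w u)%:E * L u)%E ->
  ae_eq nu D (fun u => (w u)%:E * L u)%E (EFin \o (fun u => fine ((w u)%:E * L u))).
Proof.
move=> iL; have := integrable_ae mD iL; apply: filterS => u + Du.
by move=> /(_ Du) /fineK /= ->.
Qed.

Let wint_fine (L : R -> \bar R) (Q : R -> R) :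
  nu.-integrable D (fun u => (w u)%:E * L u)%E -> bounded_mfun D Q ->
  wint nu D (fun u => fine ((w u)%:E * L u)) Q =
  fine (\int[nu]_(u in D) ((Q u)%:E * ((w u)%:E * L u)))%E.
Proof.
move=> iL [mQ _]; rewrite /wint /Rintegral; congr fine.
have mwL := measurable_int _ iL.
apply: ae_eq_integral => //.
- apply/measurable_EFinP; apply: measurable_funM => //.
  exact: measurableT_comp.
- by apply: emeasurable_funM => //; exact/measurable_EFinP.
- have := fine_ae iL; apply: filterS => u + Du.
  by move=> /(_ Du); rewrite /= EFinM => <-.
Qed.

(** The densities w L1 and w L2 define finite measures with the same exponential moments, so they
    agree almost everywhere, and the positive weight cancels. Finiteness is part of the conclusion
    so that points with a finite transform can be selected. *)
Lemma ae_eq_of_expRN_nat :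
  (forall k : nat,
    (\int[nu]_(u in D) ((expR (- (k%:R * u)))%:E * ((w u)%:E * L1 u)) =
     \int[nu]_(u in D) ((expR (- (k%:R * u)))%:E * ((w u)%:E * L2 u)))%E) ->
  (\int[nu]_(u in D) ((w u)%:E * L1 u) < +oo)%E ->
  (\int[nu]_(u in D) ((w u)%:E * L2 u) < +oo)%E ->
  {ae nu, forall u, D u -> L1 u = L2 u /\ (L1 u < +oo)%E}.
Proof.
move=> E Loo1 Loo2.
have i1 := integrable_wL mL1 L10 Loo1.
have i2 := integrable_wL mL2 L20 Loo2.
(* [fine] sends infinite values to 0, which alters an integrable function only on a null set. *)
pose f1 u := fine ((w u)%:E * L1 u)%E.
pose f2 u := fine ((w u)%:E * L2 u)%E.
have fi (L : R -> \bar R) : nu.-integrable D (fun u => (w u)%:E * L u)%E ->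
    nu.-integrable D (EFin \o (fun u => fine ((w u)%:E * L u)%E)).
  move=> iL; apply/integrableP.
  have mF : measurable_fun D (EFin \o (fun u => fine ((w u)%:E * L u)%E)).
    apply/measurable_EFinP; apply: measurableT_comp => //.
    exact: measurable_int iL.
  split=> //; have /integrableP[mwL] := iL; congr (_ < _)%E.
  apply: ae_eq_integral => //; [exact: measurableT_comp..|].
  have := fine_ae iL; apply: filterS => u + Du.
  by move=> /(_ Du) ->.
have f0 (L : R -> \bar R) : (forall u, D u -> (0 <= L u)%E) ->
    forall u, D u -> 0 <= fine ((w u)%:E * L u)%E.
  by move=> L0 u Du; rewrite fine_ge0// mule_ge0 ?L0// lee_fin ltW// w0.
have eqA : forall A, measurable A -> A `<=` D ->
    (\int[nu]_(x in A) (f1 x)%:E = \int[nu]_(x in A) (f2 x)%:E)%E.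
  apply: (eq_integral_of_expRN_nat mD D0 (fi _ i1) (fi _ i2) (f0 _ L10) (f0 _ L20)).
  move=> k; have bk := @bounded_mfun_expRN R D D0 _ (ler0n R k).
  by rewrite !wint_fine// E.
have f12 : ae_eq nu D (EFin \o f1) (EFin \o f2).
  apply: integral_ae_eq => //; first exact: fi.
    by have := fi _ i2; exact: measurable_int.
  by move=> A AD mA; exact: eqA.
have h1 := fine_ae i1; have h2 := fine_ae i2; have h3 := integrable_ae mD i1.
apply: filterS3 (filterI f12 h1) h2 h3 => u [f12u h1u] h2u h3u Du.
have wE : ((w u)%:E * L1 u = (w u)%:E * L2 u)%E.
  by rewrite (h1u Du) (h2u Du) (f12u Du).
have wfin : (w u)%:E \is a fin_num by [].
have w_gt0 : (0 < (w u)%:E)%E by rewrite lte_fin w0.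
have wV (x : \bar R) : (((w u)^-1)%:E * ((w u)%:E * x) = x)%E.
  by rewrite muleA -EFinM mulVf ?mul1e// gt_eqF// w0.
split; first by rewrite -(wV (L1 u)) wE wV.
by rewrite -(lte_pmul2l wfin w_gt0) gt0_muley// ltey_eq (h3u Du).
Qed.

End ae_eq_of_exponential_moments.

(* [lebesgue_measure] lives on [measurableTypeR R], whose measure display is
   not the one of [R], so that its integrals are not convertible to integrals
   on [R]; [borel_lebesgue] is the same set function on [R]. *)
Definition borel_lebesgue (R : realType) : set R -> \bar R :=
  fun A => @lebesgue_measure R A.

Section borel_lebesgue.
Context {R : realType}.
Local Notation leb := (@borel_lebesgue R).

Let leb0 : leb set0 = 0%E. Proof. exact: (@measure0 _ _ _ (@lebesgue_measure R)). Qed.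

Let leb_ge0 (A : set R) : (0 <= leb A)%E.
Proof. exact: (@measure_ge0 _ _ _ (@lebesgue_measure R)). Qed.

Let leb_sigma_additive : semi_sigma_additive leb.
Proof. exact: (@measure_semi_sigma_additive _ _ _ (@lebesgue_measure R)). Qed.

HB.instance Definition _ := isMeasure.Build _ _ _ leb
  leb0 leb_ge0 leb_sigma_additive.

Let leb_sigma_finite : sigma_finite setT leb.
Proof. exact: (@sigma_finiteT _ _ _ (@lebesgue_measure R)). Qed.

HB.instance Definition _ := Measure_isSigmaFinite.Build _ _ _ leb
  leb_sigma_finite.

Lemma ge0_integral_borel_lebesgue (D : set R) (f : R -> \bar R) :
  measurable D -> measurable_fun D f -> (forall x, D x -> (0 <= f x)%E) ->
  (\int[leb]_(x in D) f x = \int[lebesgue_measure]_(x in D) f x)%E.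
Proof.
move=> mD mf f0; pose idTR : measurableTypeR R -> R := idfun.
have mid : measurable_fun setT idTR by exact: (@measurable_id _ _ setT).
have := ge0_integral_pushforward mid lebesgue_measure mD mf.
by apply=> x /set_mem /f0.
Qed.

Lemma ae_borel_lebesgue (P : R -> Prop) :
  {ae leb, forall x, P x} -> {ae lebesgue_measure, forall x, P x}.
Proof. by move=> [N [mN N0 PN]]; exists N; split. Qed.

End borel_lebesgue.

(** * Integrals against shifts of the density *)

Lemma nneseries_pinfty_shift (R : realType) (x : nat -> R) :
  (forall i, 0 <= x i) -> (\sum_(0 <= n <oo) (x n)%:E = +oo)%E ->
  forall (k : nat) (M : R), exists n, M <= \sum_(i < n) x (k + i)%N.
Proof.
move=> x0 xoo k M; apply: contrapT => /forallNP bnd.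
pose K := \sum_(i < k) x i + M.
suff : (\sum_(0 <= n <oo) (x n)%:E <= K%:E)%E by rewrite xoo leye_eq.
apply: lime_le; first by apply: is_cvg_nneseries => n _ _; rewrite lee_fin.
apply: nearW => n; rewrite sumEFin lee_fin big_mkord.
apply: (@le_trans _ _ (\sum_(i < k + n) x i)).
  by rewrite addnC big_split_ord/= lerDl sumr_ge0.
rewrite big_split_ord/= lerD2l leNgt; apply/negP => /ltW; exact: bnd.
Qed.

(** The ball around [an n.+1] whose radius is half the distance to the nearer neighbour has positive
    measure, so it meets the set where [P] holds. Midpoints separate these balls, which makes [b]
    increasing. The sum starts at b_1, leaving b_0 free to act as a damping exponent. *)
Lemma ae_msupport_seq (R : realType) (nu : {measure set R -> \bar R})
    (an : nat -> R) (P : R -> Prop) :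
  (forall n, 0 < an n) -> (forall n, an n \in msupport nu) ->
  (forall n, an n < an n.+1) ->
  (\sum_(0 <= n <oo) ((an n)^-1)%:E = +oo)%E ->
  {ae nu, forall u, `]0, +oo[%classic u -> P u} ->
  exists b : nat -> R, [/\ forall n, P (b n), forall n, 0 < b n,
    forall n, b n < b n.+1 &
    forall M, exists n, M <= \sum_(i < n) (b i.+1)^-1].
Proof.
move=> an0 an_supp anS an_oo aeP.
have near_an n : exists u, [/\ P u,
    (an n + an n.+1) / 2 < u & u < (an n.+1 + an n.+2) / 2].
  apply: contrapT => /forallNP noP.
  pose e := Num.min (an n.+1 - an n) (an n.+2 - an n.+1) / 2.
  have := anS n; have := anS n.+1 => h2 h1.
  have e0 : 0 < e by rewrite divr_gt0// lt_min !subr_gt0 h1 h2.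
  have [N [mN N0 PN]] := aeP.
  have : ball (an n.+1) e `<=` N.
    move=> u; rewrite /ball/= ltr_norml => /andP[u1 u2]; apply: PN => /= Pu.
    have e1 : e <= (an n.+1 - an n) / 2.
      by rewrite ler_wpM2r// ge_min lexx.
    have e2 : e <= (an n.+2 - an n.+1) / 2.
      by rewrite ler_wpM2r// ge_min lexx orbT.
    have u0 : 0 < u by have := an0 n; lra.
    apply: (noP u); split; [|lra|lra].
    by apply: Pu; rewrite in_itv/= u0.
  move=> bN.
  have : (nu (ball (an n.+1) e) <= nu N)%E.
    by apply: le_measure; rewrite ?inE//; exact: measurable_ball.
  rewrite N0 leNgt => /negP; apply.
  by have := an_supp n.+1; rewrite inE; apply.
have /choice[b hb] := near_an.
have bS n : b n < b n.+1.
  have [_ _ h1] := hb n; have [_ h2 _] := hb n.+1.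
  exact: lt_trans h1 h2.
have b0 n : 0 < b n.
  have [_ h1 _] := hb n; apply: le_lt_trans h1.
  by rewrite divr_ge0// addr_ge0// ltW.
exists b; split=> //; first by move=> n; have [] := hb n.
move=> M.
(* The shift is 3 because b_{i+1} lies below the midpoint of a_{i+2} and a_{i+3}, hence below
   a_{i+3}. *)
have [|n hn] := nneseries_pinfty_shift _ an_oo 3 M.
  by move=> i; rewrite invr_ge0 ltW.
exists n; apply: le_trans hn _; apply: ler_sum => i _.
rewrite lef_pV2 ?posrE//; have [_ _ /ltW/le_trans] := hb i.+1; apply.
by rewrite add3n; have := anS i.+2; lra.
Qed.

Section integral_against_shifts.
Context {R : realType}.
Variables (f : R -> R) (a : R) (nu : {sigma_finite_measure set R -> \bar R}).
Hypothesis fE : forall t, a < t ->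
  (f t)%:E = (\int[nu]_(u in `]0%R, +oo[) (expR (- (u * t)))%:E)%E.
Local Notation leb := (@borel_lebesgue R).
Local Notation D := (`[0%R, +oo[%classic : set R).

Lemma measurable_expRN (E : set R) (t : R) :
  measurable_fun E (fun u : R => expR (- (u * t))).
Proof.
apply: measurable_funTS; apply: measurableT_comp => //.
by apply: measurableT_comp => //; exact: measurable_funM.
Qed.

Lemma integral_shift_laplace (g : R -> R) (t : R) : a < t ->
  measurable_fun setT g -> (forall s, 0 <= g s) ->
  (\int[leb]_(s in D) (f (t + s) * g s)%:E =
   \int[nu]_(u in `]0%R, +oo[)
     ((expR (- (u * t)))%:E * laplace leb D g u))%E.
Proof.
move=> at_ mg g0.
have <- := @integral_laplace R leb nu D `]0%R, +oo[%classic g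
  (fun u => expR (- (u * t))) (measurable_itv _) (measurable_itv _) mg g0
  (measurable_expRN _) (fun u => expR_ge0 _).
apply: eq_integral => s /set_mem/=; rewrite in_itv/= andbT => s0.
rewrite EFinM fE; last by rewrite (lt_le_trans at_)// lerDl.
rewrite -ge0_integralZr//.
- apply: eq_integral => u _; rewrite -EFinM; congr EFin.
  by rewrite mulrA -expRD mulrDr opprD.
- by apply/measurable_EFinP; exact: measurable_expRN.
- by rewrite lee_fin.
Qed.

Variable an : nat -> R.
Hypotheses (an0 : forall n, 0 < an n) (an_supp : forall n, an n \in msupport nu).
Hypotheses (anS : forall n, an n < an n.+1)
           (an_oo : (\sum_(0 <= n <oo) ((an n)^-1)%:E = +oo)%E).

Lemma ae_eq_of_integral_shift (g1 g2 : R -> R) :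
  measurable_fun D g1 -> measurable_fun D g2 ->
  (forall s, 0 <= s -> 0 <= g1 s) -> (forall s, 0 <= s -> 0 <= g2 s) ->
  (forall t, a < t ->
    (\int[leb]_(s in D) (f (t + s) * g1 s)%:E < +oo)%E) ->
  (forall t, a < t ->
    (\int[leb]_(s in D) (f (t + s) * g1 s)%:E =
     \int[leb]_(s in D) (f (t + s) * g2 s)%:E)%E) ->
  {ae leb, forall s, D s -> g1 s = g2 s}.
Proof.
move=> mg1 mg2 g10 g20 g1oo g12.
have mD : measurable D by [].
pose G1 := g1 \_ D; pose G2 := g2 \_ D.
have GD (g : R -> R) s : D s -> (g \_ D) s = g s by move=> Ds; rewrite patchE mem_set.
have mG (g : R -> R) : measurable_fun D g -> measurable_fun setT (g \_ D).
  by move=> mg; exact: (measurable_restrictT g mD).1.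
have G0 (g : R -> R) : (forall s, 0 <= s -> 0 <= g s) -> forall s, 0 <= (g \_ D) s.
  move=> g0 s; rewrite patchE; case: ifPn => // /set_mem/=.
  by rewrite in_itv/= andbT => /g0.
have GE (g : R -> R) t : (\int[leb]_(s in D) (f (t + s) * g s)%:E =
    \int[leb]_(s in D) (f (t + s) * (g \_ D) s)%:E)%E.
  by apply: eq_integral => s /set_mem Ds; rewrite GD.
pose L1 := laplace leb D G1.
pose L2 := laplace leb D G2.
have L0 g u : (forall s, 0 <= g s) -> (0 <= laplace leb D g u)%E.
  by move=> g0; apply: integral_ge0 => s _; rewrite lee_fin mulr_ge0// expR_ge0.
(* The formula for [f] requires t > a; sampling at t = a + 1 + k leaves a fixed weight [w] and the
   factor e^{-ku}. *)
pose t0 := a + 1.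
pose w (u : R) := expR (- (u * t0)).
have t0k (k : nat) : a < t0 + k%:R.
  by rewrite /t0 -addrA ltrDl ltr_wpDr.
have kL (g : R -> R) (k : nat) : measurable_fun D g ->
    (forall s, 0 <= s -> 0 <= g s) ->
   (\int[nu]_(u in `]0%R, +oo[) ((expR (- (k%:R * u)))%:E *
      ((w u)%:E * laplace leb D (g \_ D) u)) =
    \int[leb]_(s in D) (f (t0 + k%:R + s) * g s)%:E)%E.
  move=> mg g0; rewrite GE (integral_shift_laplace (t0k k) (mG _ mg) (G0 _ g0)).
  apply: eq_integral => u _; rewrite muleA -EFinM -expRD.
  by congr ((expR _)%:E * _)%E; ring.
have wL (g : R -> R) : measurable_fun D g -> (forall s, 0 <= s -> 0 <= g s) ->
   (\int[nu]_(u in `]0%R, +oo[) ((w u)%:E * laplace leb D (g \_ D) u) =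
    \int[leb]_(s in D) (f (t0 + s) * g s)%:E)%E.
  move=> mg g0; rewrite -[in RHS](addr0 t0) -(kL g 0%N mg g0).
  by apply: eq_integral => u _; rewrite mul0r oppr0 expR0 mul1e.
have at0 : a < t0 by rewrite /t0 ltrDl.
have aeL : {ae nu, forall u, `]0%R, +oo[%classic u -> L1 u = L2 u /\ (L1 u < +oo)%E}.
  apply: (@ae_eq_of_expRN_nat R nu `]0%R, +oo[%classic w L1 L2).
  - exact: measurable_itv.
  - by move=> u /=; rewrite !in_itv/= !andbT => /ltW.
  - exact: measurable_expRN.
  - by move=> u _; exact: expR_gt0.
  - by apply: measurable_laplace => //; [exact: mG|exact: G0].
  - by apply: measurable_laplace => //; [exact: mG|exact: G0].
  - by move=> u _; apply: L0; exact: G0.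
  - by move=> u _; apply: L0; exact: G0.
  - by move=> k; rewrite (kL _ _ mg1 g10) (kL _ _ mg2 g20) g12.
  - by rewrite (wL _ mg1 g10) g1oo.
  - by rewrite (wL _ mg2 g20) -g12// g1oo.
have [b [bL b0 bS boo]] := ae_msupport_seq an0 an_supp anS an_oo aeL.
(* Both transforms are finite at c, so e^{-cs} makes both functions integrable. Damping translates
   the transforms by c: exponent 0 corresponds to b_0, and the exponents b_{n+1} - c are smaller
   than b_{n+1}, so their inverses still have a divergent sum. *)
pose c := b 0%N.
have bc n : c < b n.+1.
  elim: n => [|n ih]; first exact: bS.
  exact: lt_trans ih (bS _).
pose F (g : R -> R) (s : R) := expR (- (c * s)) * (g \_ D) s.
have mF (g : R -> R) : measurable_fun D g -> measurable_fun setT (F g).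
  move=> mg; apply: measurable_funM; last exact: mG.
  by under eq_fun do rewrite mulrC; exact: measurable_expRN.
have F0 (g : R -> R) : (forall s, 0 <= s -> 0 <= g s) -> forall s, 0 <= F g s.
  by move=> g0 s; rewrite mulr_ge0 ?expR_ge0// G0.
have iF (g : R -> R) : measurable_fun D g -> (forall s, 0 <= s -> 0 <= g s) ->
    (laplace leb D (g \_ D) c < +oo)%E ->
    leb.-integrable D (EFin \o F g).
  move=> mg g0 Loo; apply/integrableP; split.
    by apply/measurable_EFinP; apply: measurable_funTS; exact: mF.
  move: Loo; congr (_ < _)%E; apply: eq_integral => s _.
  by rewrite /= ger0_norm// F0.
have wF g z : wint leb D (F g) (fun s => expR (- (z * s))) =
    fine (laplace leb D (g \_ D) (z + c)).
  rewrite /wint /Rintegral; congr fine; apply: eq_integral => s _; congr EFin.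
  by rewrite /F mulrA -expRD mulrDl opprD.
have iF1 := iF _ mg1 g10 (bL 0%N).2.
have iF2 : leb.-integrable D (EFin \o F g2).
  by have [L12 Loo] := bL 0%N; apply: iF => //;
    rewrite -[laplace _ _ _ _]/(L2 (b 0%N)) -L12.
have F12 := @muntz R leb leb D (F g1) (F g2) mD
  (@subset_refl _ _) iF1 iF2 (fun s _ => F0 _ g10 s) (fun s _ => F0 _ g20 s)
  (fun n => b n.+1 - c).
have /(integral_ae_eq mD iF1) : forall E, E `<=` D -> measurable E ->
   (\int[leb]_(x in E) (EFin \o F g1) x =
    \int[leb]_(x in E) (EFin \o F g2) x)%E.
  move=> E ED mE; apply: F12 => //.
  - by move=> i; rewrite subr_gt0.
  - by move=> i; rewrite ltrD2r.
  - move=> M; have [n hn] := boo M; exists n; apply: le_trans hn _.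
    apply: ler_sum => i _; rewrite lef_pV2 ?posrE ?subr_gt0//.
    by rewrite gerBl; exact: ltW (b0 0%N).
  - by rewrite !wF add0r; congr fine; exact: (bL 0%N).1.
  - by move=> i; rewrite !wF subrK; congr fine; exact: (bL i.+1).1.
have mF2 : measurable_fun D (EFin \o F g2) by exact: measurable_int iF2.
move=> /(_ mF2); apply: filterS => s + Ds; move=> /(_ Ds) [].
by move=> /mulfI; rewrite !GD//; apply; rewrite gt_eqF// expR_gt0.
Qed.

End integral_against_shifts.

(** * Convolution squares on half-lines *)

(** On ]0, n] the integrand is at least e^{-nt}, so a finite transform at a single t bounds the mass
    there. This makes Tonelli's theorem available for [nu]. *)
Lemma sigma_finite_of_laplace (R : realType) (nu : {measure set R -> \bar R})
    (t : R) : 0 < t -> nu `]-oo, 0]%classic = 0%E ->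
  (\int[nu]_(u in `]0%R, +oo[) (expR (- (u * t)))%:E < +oo)%E ->
  sigma_finite [set: R] nu.
Proof.
move=> t0 nu0 Loo; exists (fun n => `]-oo, n%:R]%classic).
  apply/esym/seteqP; split=> // x _.
  by exists (Num.truncn x).+1 => //=; rewrite in_itv/= ltW// truncnS_gt.
move=> n; split; first exact: measurable_itv.
have mexp (E : set R) : measurable_fun E (fun u : R => (expR (- (u * t)))%:E).
  by apply/measurable_EFinP; exact: measurable_expRN.
have nu_n : (nu `]0%R, n%:R]%classic < +oo)%E.
  have en : (0 < (expR (- (n%:R * t)))%:E)%E by rewrite lte_fin expR_gt0.
  rewrite -(@lte_pmul2l _ (expR (- (n%:R * t)))%:E)// gt0_muley//.
  apply: le_lt_trans Loo; rewrite -integral_cst//.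
  apply: (@le_trans _ _ (\int[nu]_(u in `]0%R, n%:R]) (expR (- (u * t)))%:E)%E).
    apply: ge0_le_integral => //.
    - by move=> u _; rewrite /= lee_fin expR_ge0.
    - move=> u /=; rewrite in_itv/= => /andP[_ un].
      by rewrite lee_fin ler_expR lerN2 ler_wpM2r// ltW.
  apply: ge0_subset_integral => //.
  by move=> u /=; rewrite !in_itv/= andbT => /andP[].
apply: le_lt_trans nu_n.
rewrite (_ : `]-oo, n%:R]%classic = `]-oo, 0%R] `|` `]0%R, n%:R]); last first.
  apply/seteqP; split=> x /=; rewrite !in_itv/=.
    by move=> ->; case: (leP x 0) => _; [left|right].
  by move=> [/le_trans|/andP[]//]; apply.
have : (nu (`]-oo, 0%R] `|` `]0%R, n%:R]) <=
    nu `]-oo, 0%R]%classic + nu `]0%R, n%:R]%classic)%E by exact: measureU2.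
by rewrite nu0 add0e.
Qed.

(** The factor 1/u is written [expR (- ln u)], so that the weights built from it are products of
    exponentials, nonnegative for every real u. *)
Lemma integral_expRN_ray (R : realType) (u b : R) : 0 < u ->
  (\int[@borel_lebesgue R]_(y in `]b, +oo[) (expR (- (u * y)))%:E =
   (expR (- (u * b)) * expR (- ln u))%:E)%E.
Proof.
move=> u0.
have me (E : set R) : measurable_fun E (fun y : R => (expR (- (u * y)))%:E).
  apply/measurable_EFinP; under eq_fun do rewrite mulrC.
  exact: measurable_expRN.
rewrite ge0_integral_borel_lebesgue//.
rewrite integral_itv_obnd_cbnd//.
have D (x : R) : is_derive x 1 (fun y => - (expR (- (u * y)) / u)) (expR (- (u * x))).
  have -> : (fun y => - (expR (- (u * y)) / u)) = (fun y => - u^-1 * expR (- u * y)).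
    by apply/funext => y; rewrite mulNr mulNr mulrC.
  have h := is_derive_expRM (- u) x.
  apply: is_derive_eq; rewrite /GRing.scale/= !mulNr.
  by field; rewrite gt_eqF.
rewrite (@ge0_continuous_FTC2y _ _ (fun y => - (expR (- (u * y)) / u)) _ 0)//.
- by rewrite -EFinB sub0r opprK (expRN (ln u)) lnK ?posrE.
- apply: continuous_subspaceT => x.
  apply: continuous_comp; last exact: continuous_expR.
  by apply: continuousN; apply: continuousM => //; exact: cst_continuous.
- rewrite -oppr0; apply: cvgN; rewrite -[X in _ --> X](mul0r u^-1).
  apply: cvgMl.
  apply: (@cvg_comp _ _ _ (fun z => u * z) (fun z => expR (- z))
    _ (pinfty_nbhs R)); last exact: cvgr_expR.
  exact: gt0_cvgMry.
- apply: cvg_at_right_filter.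
  suff : {for b, continuous (fun y => - (expR (- (u * y)) / u))} by [].
  by apply: differentiable_continuous; apply/derivable1_diffP; exact: ex_derive.
- by move=> x _; rewrite derive1E; exact: derive_val.
Qed.

Section convolution_square_on_rays.
Context {R : realType}.
Variable (c : R).
Hypothesis c0 : 0 <= c.
Local Notation Dp := (`[0%R, +oo[%classic : set R).
Local Notation Dn := (`]-oo, 0%R[%classic : set R).

Let S := [set z : R * R | c < z.1 + z.2].
Let k (z : R * R) : \bar R := (\1_S z)%:E.

Let mS : measurable S.
Proof.
rewrite -[S]setTI (_ : S = (fun z : R * R => z.1 + z.2) @^-1` `]c, +oo[).
  by apply: measurable_funD => //; exact: measurable_itv.
by apply/seteqP; split=> z /=; rewrite in_itv/= andbT.
Qed.

Let mk : measurable_fun setT k.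
Proof. by apply/measurable_EFinP; exact: measurable_indic. Qed.

Let k0 z : (0 <= k z)%E. Proof. by rewrite lee_fin. Qed.

Let kC x y : k (x, y) = k (y, x).
Proof.
rewrite /k !indicE; congr ((nat_of_bool _)%:R%:E).
by apply/idP/idP => /set_mem h; apply/mem_set; move: h; rewrite /S /= addrC.
Qed.

Let mk1 (E : set R) x : measurable_fun E (fun y => k (x, y)).
Proof. by apply: measurable_funTS; exact: measurableT_comp. Qed.

Let mF (m : probability R R) (E F : set R) : measurable E -> measurable F ->
  measurable_fun F (fun x => \int[m]_(y in E) k (x, y))%E.
Proof.
move=> mE mF.
rewrite (_ : (fun x => _) = (fun x => \int[m]_(y in E) k (y, x))%E).
  exact: (@measurable_tonelli_on R m E F k).
by apply/funext => x; apply: eq_integral => y _; rewrite kC.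
Qed.

Let DpnT : Dp `|` Dn = [set: R].
Proof.
apply/seteqP; split=> // x _; rewrite /= !in_itv/= andbT.
by case: (leP 0 x) => _; [left|right].
Qed.

Let Dpn0 : [disjoint Dp & Dn].
Proof.
rewrite disj_set2E; apply/eqP/seteqP; split=> // x [] /=.
by rewrite !in_itv/= andbT leNgt => /negP.
Qed.

Let rayE x : [set y | `]c, +oo[%classic (x + y)] = `]c - x, +oo[%classic.
Proof. by apply/seteqP; split=> y /=; rewrite !in_itv/= !andbT ltrBlDl. Qed.

Let kE x y : k (x, y) = (\1_(`]c - x, +oo[%classic) y)%:E.
Proof.
rewrite /k !indicE; congr ((nat_of_bool _)%:R%:E).
apply/idP/idP => /set_mem h; apply/mem_set; move: h;
  by rewrite /S /= in_itv/= andbT ltrBlDl.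
Qed.

(** Mass of the section at x of the half-plane x + y > c, cut to y >= 0. It depends only on the
    half-line part of [m], so it is the same function for two measures that agree there. *)
Definition pos_ray (m : set R -> \bar R) (x : R) : \bar R :=
  m (`]c - x, +oo[ `&` Dp).

Let pos_rayE (m : probability R R) x :
  (\int[m]_(y in Dp) k (x, y) = pos_ray m x)%E.
Proof.
rewrite /pos_ray -integral_indic//; first by apply: eq_integral => y _; rewrite kE.
Qed.

Lemma measurable_pos_ray (m : probability R R) (E : set R) :
  measurable E -> measurable_fun E (pos_ray m).
Proof.
move=> mE; rewrite (_ : pos_ray m = (fun x => \int[m]_(y in Dp) k (x, y))%E).
  exact: mF.
by apply/funext => x; rewrite pos_rayE.
Qed.

Lemma integral_pos_ray_fin_num (m m' : probability R R) (E : set R) :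
  measurable E -> (\int[m']_(x in E) pos_ray m x)%E \is a fin_num.
Proof.
move=> mE; have p0 x : (0 <= pos_ray m x)%E by exact: measure_ge0.
rewrite ge0_fin_numE ?integral_ge0//.
apply: (@le_lt_trans _ _ (\int[m']_(x in E) cst 1%E x)%E).
  apply: ge0_le_integral => //; first exact: measurable_pos_ray.
  by move=> x _; apply: probability_le1; exact: measurableI.
by rewrite integral_cst// mul1e (le_lt_trans (probability_le1 _ _))// ltry.
Qed.

(** The plane is cut into quadrants: the negative one misses x + y > c since c >= 0, and the two
    mixed ones have equal mass by Tonelli and symmetry. *)
Lemma mconv_ray (m : probability R R) :
  (mconv m m `]c, +oo[ =
   \int[m]_(x in Dp) pos_ray m x + (\int[m]_(x in Dn) pos_ray m x +
     \int[m]_(x in Dn) pos_ray m x))%E.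
Proof.
have F0 (E : set R) x : (0 <= \int[m]_(y in E) k (x, y))%E by apply: integral_ge0.
have splitE (F : R -> \bar R) : measurable_fun setT F -> (forall x, (0 <= F x)%E) ->
    (\int[m]_x F x = \int[m]_(x in Dp) F x + \int[m]_(x in Dn) F x)%E.
  by move=> mF' F0'; rewrite -ge0_integral_setU// ?DpnT.
have mE (x : R) : (m [set y | `]c, +oo[%classic (x + y)%R] =
    \int[m]_(y in Dp) k (x, y) + \int[m]_(y in Dn) k (x, y))%E.
  rewrite -splitE//.
  rewrite rayE -[X in m X]setIT -integral_indic//.
  by apply: eq_integral => y _; rewrite kE.
rewrite /mconv; under eq_integral do rewrite mE.
rewrite ge0_integralD//; [|exact: mF|exact: mF].
rewrite !splitE//; [|exact: mF|exact: mF].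
have nn0 : (\int[m]_(x in Dn) \int[m]_(y in Dn) k (x, y) = 0)%E.
  apply: integral0_eq => x /=; rewrite in_itv/= => x0.
  apply: integral0_eq => y /=; rewrite in_itv/= => y0.
  rewrite /k indicE memNset//; rewrite /S /=; have := c0; lra.
have pn : (\int[m]_(x in Dp) \int[m]_(y in Dn) k (x, y) =
    \int[m]_(x in Dn) \int[m]_(y in Dp) k (x, y))%E.
  apply: etrans (@tonelli_on R m m Dp Dn k (measurable_itv _)
    (measurable_itv _) mk k0) _.
  by apply: eq_integral => x _; apply: eq_integral => y _; rewrite kC.
rewrite nn0 pn -addeA; congr (_ + (_ + _))%E.
- by apply: eq_integral => x _; rewrite pos_rayE.
- by apply: eq_integral => x _; rewrite pos_rayE.
- by apply: etrans (adde0 _) _; apply: eq_integral => x _; rewrite pos_rayE.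
Qed.

End convolution_square_on_rays.

(** * Recovery of the negative half-line from the cross term *)

Section reflection.
Context {R : realType}.

Definition oppR (x : R) : R := - x.

Let measurable_oppR : measurable_fun setT oppR.
Proof. exact: oppr_measurable. Qed.

HB.instance Definition _ := isMeasurableFun.Build _ _ _ _ oppR measurable_oppR.

Definition reflection (m : probability R R) : probability R R :=
  distribution m oppR.

Lemma ge0_integral_reflection (m : probability R R) (D : set R)
    (F : R -> \bar R) :
  measurable D -> measurable_fun D F -> (forall x, D x -> (0 <= F x)%E) ->
  (\int[reflection m]_(s in D) F s = \int[m]_(x in oppR @^-1` D) F (- x)%R)%E.
Proof.
move=> mD mF F0.
by rewrite (ge0_integral_pushforward measurable_oppR)// => x /set_mem /F0.
Qed.

End reflection.

Section half_line_characterization.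
Context {R : realType}.
Variables (mu mu1 : probability R R) (f : R -> R) (a : R).
Variables (nu : {sigma_finite_measure set R -> \bar R}) (an : nat -> R).
Hypotheses (mf : measurable_fun setT f) (f0 : forall x, 0 <= f x).
Hypothesis muE : forall A : set R, measurable A ->
  mu A = (\int[lebesgue_measure]_(x in A) (f x)%:E)%E.
Hypothesis a0 : 0 <= a.
Hypothesis fE : forall t, a < t ->
  (f t)%:E = (\int[nu]_(u in `]0%R, +oo[) (expR (- (u * t)))%:E)%E.
Hypotheses (an0 : forall n, 0 < an n) (an_supp : forall n, an n \in msupport nu).
Hypotheses (anS : forall n, an n < an n.+1)
           (an_oo : (\sum_(0 <= n <oo) ((an n)^-1)%:E = +oo)%E).
Local Notation leb := (@borel_lebesgue R).
Local Notation Dp := (`[0%R, +oo[%classic : set R).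
Local Notation Dn := (`]-oo, 0%R[%classic : set R).
Local Notation U := (`]0%R, +oo[%classic : set R).
Hypothesis eq_pos : forall A : set R, measurable A -> A `<=` Dp -> mu1 A = mu A.
Hypothesis eq_conv : forall A : set R, measurable A -> A `<=` Dp ->
  mconv mu1 mu1 A = mconv mu mu A.

Let mexp2 : measurable_fun setT (fun z : R * R => (expR (- (z.2 * z.1)))%:E).
Proof.
apply/measurable_EFinP; apply: measurableT_comp => //.
by apply: measurableT_comp => //; exact: measurable_funM.
Qed.

(** Integrating e^{-uy} over the ray shows that the tails of [mu] are Laplace transforms too, with
    an additional weight 1/u. The ray being open, b = a is allowed. *)
Lemma density_ray (b : R) : a <= b -> mu `]b, +oo[%classic =
  (\int[nu]_(u in U) (expR (- (u * b)) * expR (- ln u))%:E)%E.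
Proof.
move=> ab; rewrite muE; last exact: measurable_itv.
rewrite -ge0_integral_borel_lebesgue; last 3 first.
- exact: measurable_itv.
- by apply/measurable_EFinP; exact: measurable_funTS.
- by move=> x _; rewrite lee_fin.
transitivity (\int[leb]_(y in `]b, +oo[)
    \int[nu]_(u in U) (expR (- (u * y)))%:E)%E.
  apply: eq_integral => y /set_mem /=; rewrite in_itv/= andbT => yb.
  by rewrite fE// (le_lt_trans ab).
apply: etrans (@tonelli_on R leb nu `]b, +oo[%classic U _
  (measurable_itv _) (measurable_itv _) mexp2 _) _.
  by move=> z; rewrite lee_fin expR_ge0.
apply: eq_integral => u /set_mem /=; rewrite in_itv/= andbT => u0.
exact: integral_expRN_ray.
Qed.

Let w (c u : R) := expR (- (u * c)) * expR (- ln u).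

Let mw c : measurable_fun setT (w c).
Proof.
apply: measurable_funM; first exact: measurable_expRN.
by apply: measurableT_comp => //; apply: measurableT_comp.
Qed.

Let w0 c u : 0 <= w c u. Proof. by rewrite mulr_ge0 ?expR_ge0. Qed.

Let L m := laplace (reflection m) U (cst 1).

(** For x = -s < 0 the inner mass is the tail of [mu] beyond c + s, an integral of e^{-uc} e^{-us} /
    u; exchanging integrals isolates the transform of the reflected measure. *)
Lemma integral_pos_ray (m : probability R R) (c : R) : a <= c ->
  (\int[m]_(x in Dn) pos_ray c mu x = \int[nu]_(u in U) ((w c u)%:E * L m u))%E.
Proof.
move=> ac.
pose H (s : R) := (\int[nu]_(u in U) (w c u * (expR (- (u * s)) * cst 1 s))%:E)%E.
have mH : measurable_fun U H.
  apply: (@measurable_tonelli_on R nu U U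
    (fun z => (w c z.1 * (expR (- (z.1 * z.2)) * cst 1 z.2))%:E)).
  - exact: measurable_itv.
  - exact: measurable_itv.
  - apply/measurable_EFinP; apply: measurable_funM.
      exact: measurableT_comp.
    apply: measurable_funM => //; apply: measurableT_comp => //.
    by apply: measurableT_comp => //; exact: measurable_funM.
  - by move=> z; rewrite lee_fin !mulr_ge0 ?expR_ge0.
have H0 s : (0 <= H s)%E.
  by apply: integral_ge0 => u _; rewrite lee_fin !mulr_ge0 ?expR_ge0.
apply: etrans (@integral_laplace R (reflection m) nu U U (cst 1) (w c)
  (measurable_itv _) (measurable_itv _) (measurable_cst _) (fun=> ler01) (mw c) (w0 c)).
rewrite [RHS](@ge0_integral_reflection R m U H)//.
rewrite (_ : oppR @^-1` U = Dn); last first.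
  by apply/seteqP; split=> x /=; rewrite !in_itv/= andbT oppr_gt0.
apply: eq_integral => x /set_mem/=; rewrite in_itv/= => x0.
(* Here c - x >= 0, so the ray already lies in [Dp]. *)
rewrite /pos_ray setIidl; last first.
  move=> y /=; rewrite !in_itv/= !andbT => /ltW; apply: le_trans.
  by rewrite subr_ge0 (le_trans (ltW x0))// (le_trans a0).
rewrite density_ray; last by rewrite (le_trans ac)// lerBrDr gerDl ltW.
apply: eq_integral => u _; congr EFin; rewrite /w /= mulr1 -!expRD.
by congr expR; ring.
Qed.

(** The term over [Dp] is finite and common to both measures, so it cancels; the cross term occurs
    twice, and halving gives the claim. *)
Lemma integral_pos_ray_eq (c : R) : a <= c ->
  (\int[mu1]_(x in Dn) pos_ray c mu x = \int[mu]_(x in Dn) pos_ray c mu x)%E.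
Proof.
move=> ac; have c0 : 0 <= c by exact: le_trans ac.
have := eq_conv (measurable_itv `]c, +oo[).
rewrite !mconv_ray//.
have -> : pos_ray c mu1 = pos_ray c mu.
  apply/funext => x; apply: eq_pos; first by apply: measurableI; exact: measurable_itv.
  by move=> y [].
have -> : (\int[mu1]_(x in Dp) pos_ray c mu x =
    \int[mu]_(x in Dp) pos_ray c mu x)%E.
  by apply: eq_measure_integral => A mA AD; exact: eq_pos.
have sub : `]c, +oo[ `<=` Dp.
  by move=> x /=; rewrite !in_itv/= !andbT => /ltW; exact: le_trans.
move=> /(_ sub) /fin_num_addeI.
have fin m m' E mE := @integral_pos_ray_fin_num R c m m' E mE.
move=> /(_ (fin _ _ _ (measurable_itv _))).
rewrite -(fineK (fin mu mu1 Dn (measurable_itv _))).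
rewrite -(fineK (fin mu mu Dn (measurable_itv _))).
rewrite -!EFinD => -[h]; congr EFin; lra.
Qed.

(** The rays from a + k, with k natural, supply the exponential moments of the two transforms
    against the weight [w a]; these are finite because [pos_ray] is bounded by 1. *)
Theorem eq_prob_of_half_line : forall A : set R, measurable A -> mu1 A = mu A.
Proof.
have aeL : {ae nu, forall u, U u -> L mu1 u = L mu u /\ (L mu1 u < +oo)%E}.
  have kE m (k : nat) : (\int[nu]_(u in U) ((expR (- (k%:R * u)))%:E *
      ((w a u)%:E * L m u)) = \int[m]_(x in Dn) pos_ray (a + k%:R) mu x)%E.
    rewrite integral_pos_ray ?lerDl//; apply: eq_integral => u _.
    rewrite muleA -EFinM; congr (_%:E * _)%E; rewrite /w -!expRD.
    by congr expR; ring.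
  have fin m : (\int[nu]_(u in U) ((w a u)%:E * L m u) < +oo)%E.
    rewrite -integral_pos_ray// -ge0_fin_numE ?integral_pos_ray_fin_num//.
    by apply: integral_ge0 => x _; exact: measure_ge0.
  apply: (@ae_eq_of_expRN_nat R nu U (w a) (L mu1) (L mu)).
  - exact: measurable_itv.
  - by move=> u /=; rewrite !in_itv/= !andbT => /ltW.
  - exact: measurable_funTS (mw a).
  - by move=> u _; rewrite mulr_gt0 ?expR_gt0.
  - by apply: measurable_laplace => //; exact: measurable_itv.
  - by apply: measurable_laplace => //; exact: measurable_itv.
  - by move=> u _; apply: integral_ge0 => s _; rewrite lee_fin mulr_ge0// expR_ge0.
  - by move=> u _; apply: integral_ge0 => s _; rewrite lee_fin mulr_ge0// expR_ge0.
  - by move=> k; rewrite !kE integral_pos_ray_eq// lerDl.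
  - exact: fin.
  - exact: fin.
have [b [bL b0 bS boo]] := ae_msupport_seq an0 an_supp anS an_oo aeL.
have DpC : ~` Dp = Dn.
  by apply/seteqP; split=> x /=; rewrite !in_itv/= andbT ltNge => /negP.
have wE m z : wint (reflection m) U (cst 1) (fun s => expR (- (z * s))) = fine (L m z).
  by [].
have one m : (reflection m).-integrable U (EFin \o cst 1).
  exact: finite_measure_integrable_cst.
have reflE m B : measurable B ->
    (\int[reflection m]_(x in B) (cst 1 x)%:E = m (oppR @^-1` B))%E.
  by move=> mB; have := integral_cst (reflection m) mB 1%E; rewrite mul1e.
have oppU : oppR @^-1` U = Dn.
  by apply/seteqP; split=> x /=; rewrite !in_itv/= andbT oppr_gt0.
(* The reflected measures are finite, so the constant density 1 is integrable and no damping
   occurs. *)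
have eqU := @muntz R (reflection mu1) (reflection mu) U (cst 1) (cst 1)
  (measurable_itv _) _ (one mu1) (one mu) (fun _ _ => ler01) (fun _ _ => ler01)
  (fun n => b n.+1).
have eq_neg B : measurable B -> B `<=` Dn -> mu1 B = mu B.
  move=> mB BD.
  have oppK : B = oppR @^-1` (oppR @^-1` B).
    by apply/seteqP; split=> x /=; rewrite /oppR opprK.
  have moB : measurable (oppR @^-1` B).
    by rewrite -[X in measurable X]setTI; exact: measurable_funP.
  rewrite oppK -!reflE//; apply: eqU => //.
  - by move=> u /=; rewrite !in_itv/= !andbT => /ltW.
  (* Exponent 0 is the total mass of the negative half-line, which is 1 minus the common mass of
     [Dp]. *)
  - rewrite !wE /L /laplace.
    under eq_integral do rewrite mul0r oppr0 expR0 mul1r.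
    under [in RHS]eq_integral do rewrite mul0r oppr0 expR0 mul1r.
    rewrite !reflE ?oppU -?DpC; [|exact: measurable_itv..].
    by rewrite !probability_setC ?eq_pos//; exact: measurable_itv.
  - by move=> i; rewrite !wE (bL _).1.
  - move=> x /BD /=; rewrite /oppR !in_itv/= andbT; lra.
move=> A mA.
rewrite -[A]setIT -(setUv Dp) DpC setIUr.
have mAp : measurable (A `&` Dp) by apply: measurableI => //; exact: measurable_itv.
have mAn : measurable (A `&` Dn) by apply: measurableI => //; exact: measurable_itv.
have disj : (A `&` Dp) `&` (A `&` Dn) = set0.
  by rewrite -DpC setIACA setICr setI0.
rewrite !measureU//; congr (_ + _)%E.
  by apply: eq_pos => // x [].
by apply: eq_neg => // x [].
Qed.

End half_line_characterization.

(** * Sigma-finiteness of [nu] and assembly of the three claims *)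

Section sigma_finite_pack.
Context {d} {T : measurableType d} {R : realType}.
Variable nu : {measure set T -> \bar R}.
Hypothesis sf : sigma_finite [set: T] nu.

(** The proof of sigma-finiteness is an argument so that the instance can depend on it; the value is
    [nu] itself, so hypotheses on [nu] carry over by conversion. *)
Definition sigma_finite_pack of sigma_finite [set: T] nu : set T -> \bar R := nu.
Local Notation nus := (sigma_finite_pack sf).

Let nus0 : nus set0 = 0%E. Proof. exact: measure0. Qed.
Let nus_ge0 (A : set T) : (0 <= nus A)%E. Proof. exact: measure_ge0. Qed.
Let nus_sigma_additive : semi_sigma_additive nus.
Proof. exact: measure_semi_sigma_additive. Qed.

HB.instance Definition _ := isMeasure.Build _ _ _ nus
  nus0 nus_ge0 nus_sigma_additive.

HB.instance Definition _ := Measure_isSigmaFinite.Build _ _ _ nus sf.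

End sigma_finite_pack.

Theorem theorem3p5 (R : realType) (mu : probability R R) (f : R -> R)
  (a : R) (nu : {measure set R -> \bar R}) (an : nat -> R) :
  (* mu is absolutely continuous with density f *)
  measurable_fun setT f ->
  (forall x, 0 <= f x) ->
  (forall A : set R, measurable A ->
     mu A = (\int[lebesgue_measure]_(x in A) (f x)%:E)%E) ->
  (* the support of mu is not included in (-oo, 0) *)
  ~ (msupport mu `<=` `]-oo, 0[%classic) ->
  (* f is completely monotone on (a, +oo): nu is a positive measure on (0,+oo) *)
  0 <= a ->
  nu `]-oo, 0]%classic = 0%E ->
  (forall t, a < t ->
     (f t)%:E = (\int[nu]_(u in `]0%R, +oo[) (expR (- (u * t)))%:E)%E) ->
  (* the support of nu (in (0,+oo)) contains an increasing sequence with
     divergent sum of inverses *)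
  (forall n, 0 < an n) ->
  (forall n, an n \in msupport nu) ->
  (forall n, an n < an n.+1) ->
  (\sum_(0 <= n <oo) ((an n)^-1)%:E = +oo)%E ->
  (* (i) *)
  (forall g1 g2 : R -> R,
     measurable_fun (`[0%R, +oo[ : set R) g1 -> measurable_fun (`[0%R, +oo[ : set R) g2 ->
     (forall s, 0 <= s -> 0 <= g1 s) -> (forall s, 0 <= s -> 0 <= g2 s) ->
     (forall t, 0 <= t ->
        (\int[lebesgue_measure]_(s in `[0%R, +oo[) (f (t + s) * g1 s)%:E < +oo)%E) ->
     (forall t, 0 <= t ->
        (\int[lebesgue_measure]_(s in `[0%R, +oo[) (f (t + s) * g2 s)%:E < +oo)%E) ->
     (forall t, 0 <= t ->
        (\int[lebesgue_measure]_(s in `[0%R, +oo[) (f (t + s) * g1 s)%:E =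
         \int[lebesgue_measure]_(s in `[0%R, +oo[) (f (t + s) * g2 s)%:E)%E) ->
     {ae lebesgue_measure, forall s, `[0%R, +oo[%classic s -> g1 s = g2 s})
  /\
  (* (ii) *)
  (forall mu1 : probability R R,
     (forall A : set R, measurable A -> A `<=` `[0%R, +oo[ -> mu1 A = mu A) ->
     (forall A : set R, measurable A -> A `<=` `[0%R, +oo[ ->
        mconv mu1 mu1 A = mconv mu mu A) ->
     forall A : set R, measurable A -> mu1 A = mu A)
  /\
  (* (iii) *)
  classC mu.
Proof.
move=> mf f0 muE _ a0 nu0 fE an0 an_supp anS an_oo.
have a1 : a < a + 1 by rewrite ltrDl.
have sf : sigma_finite [set: R] nu.
  apply: (@sigma_finite_of_laplace R nu (a + 1)) => //.
    by rewrite ltr_wpDl.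
  by rewrite -fE// ltry.
pose nus : {sigma_finite_measure set R -> \bar R} := sigma_finite_pack sf.
have part_ii mu1 := @eq_prob_of_half_line R mu mu1 f a nus an mf f0 muE a0
  fE an0 an_supp anS an_oo.
split; last split.
- move=> g1 g2 mg1 mg2 g10 g20 g1oo g2oo g12; apply: ae_borel_lebesgue.
  have bridge (g : R -> R) (t : R) : measurable_fun (`[0%R, +oo[ : set R) g ->
      (forall s, 0 <= s -> 0 <= g s) ->
      (\int[@borel_lebesgue R]_(s in `[0%R, +oo[) (f (t + s) * g s)%:E =
       \int[lebesgue_measure]_(s in `[0%R, +oo[) (f (t + s) * g s)%:E)%E.
    move=> mg g0; apply: ge0_integral_borel_lebesgue.
    + exact: measurable_itv.
    + apply/measurable_EFinP; apply: measurable_funM => //.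
      apply: measurable_funTS; apply: measurableT_comp => //.
      exact: measurable_funD.
    + move=> s /=; rewrite in_itv/= andbT => /g0 gs0.
      by rewrite lee_fin mulr_ge0.
  apply: (@ae_eq_of_integral_shift R f a nus fE an) => //.
  + by move=> t /ltW /(le_trans a0) t0; rewrite bridge// g1oo.
  + by move=> t /ltW /(le_trans a0) t0; rewrite !bridge// g12.
- exact: part_ii.
- move=> mu1 eq_pow; apply: part_ii.
  (* Indices 0 and 1 stand for the first and second convolution powers. *)
  + exact: (eq_pow 0%N).
  + exact: (eq_pow 1%N).
Qed.
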